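(* Let $w_1,w_2,w_3$ be any positive integers. Then for every integer $n\ge 0$ and all $y_1,y_2,y_3\in\mathbb{Z}_p$, the following six expressions are equal (all sums run over nonnegative integers $k,l,m$ with $k+l+m=n$): \begin{align*} &\sum_{k+l+m=n}\binom{n}{k,l,m}B_{k,\chi,\xi^{w_2w_3}}(w_1y_1)\,B_{l,\chi,\xi^{w_1w_3}}(w_2y_2)\,B_{m,\chi,\xi^{w_1w_2}}(w_3y_3)\,w_1^{l+m}w_2^{k+m}w_3^{k+l}\\ =&\sum_{k+l+m=n}\binom{n}{k,l,m}B_{k,\chi,\xi^{w_2w_3}}(w_1y_1)\,B_{l,\chi,\xi^{w_1w_2}}(w_3y_2)\,B_{m,\chi,\xi^{w_1w_3}}(w_2y_3)\,w_1^{l+m}w_3^{k+m}w_2^{k+l}\\ =&\sum_{k+l+m=n}\binom{n}{k,l,m}B_{k,\chi,\xi^{w_1w_3}}(w_2y_1)\,B_{l,\chi,\xi^{w_2w_3}}(w_1y_2)\,B_{m,\chi,\xi^{w_1w_2}}(w_3y_3)\,w_2^{l+m}w_1^{k+m}w_3^{k+l}\\ =&\sum_{k+l+m=n}\binom{n}{k,l,m}B_{k,\chi,\xi^{w_1w_3}}(w_2y_1)\,B_{l,\chi,\xi^{w_1w_2}}(w_3y_2)\,B_{m,\chi,\xi^{w_2w_3}}(w_1y_3)\,w_2^{l+m}w_3^{k+m}w_1^{k+l}\\ =&\sum_{k+l+m=n}\binom{n}{k,l,m}B_{k,\chi,\xi^{w_1w_2}}(w_3y_1)\,B_{l,\chi,\xi^{w_2w_3}}(w_1y_2)\,B_{m,\chi,\xi^{w_1w_3}}(w_2y_3)\,w_3^{l+m}w_1^{k+m}w_2^{k+l}\\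 =&\sum_{k+l+m=n}\binom{n}{k,l,m}B_{k,\chi,\xi^{w_1w_2}}(w_3y_1)\,B_{l,\chi,\xi^{w_1w_3}}(w_2y_2)\,B_{m,\chi,\xi^{w_2w_3}}(w_1y_3)\,w_3^{l+m}w_2^{k+m}w_1^{k+l}. \end{align*}
   Context: Let $p$ be a fixed prime, $\mathbb{Z}_p$ the ring of $p$-adic integers, and $\mathbb{C}_p$ the completion of an algebraic closure of $\mathbb{Q}_p$. Let $\Gamma_r=\{\xi\in\mathbb{C}_p : \xi^{p^s}=1 \text{ for some } s\in\mathbb{Z}_{>0}\}$ (ramified roots of unity) and fix any $\xi\in\Gamma_r$. Let $d$ be a fixed positive integer and $\chi$ a (primitive) Dirichlet character of conductor $d$, viewed as a function $\mathbb{Z}\to\mathbb{C}_p$ via a fixed embedding $\overline{\mathbb{Q}}\to\mathbb{C}_p$ (periodic mod $d$, zero on integers not coprime to $d$; if $d=1$, $\chi\equiv 1$). For $\eta\in\Gamma_r$, the generalized twisted Bernoulli polynomials $B_{n,\chi,\eta}(x)$ attached to $\chi$ and $\eta$ are the polynomials in $x$ with coefficients in $\mathbb{C}_p$ defined by the power series expansion in $t$ $$\frac{te^{xt}}{\eta^{d}e^{dt}-1}\sum_{a=0}^{d-1}\chi(a)\eta^{a}e^{at}=\sum_{n=0}^{\infty}B_{n,\chi,\eta}(x)\frac{t^n}{n!}.$$ Also $\binom{n}{k,l,m}=\frac{n!}{k!\,l!\,m!}$. *)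

(* Defs.v *)
From HB Require Import structures.
From mathcomp Require Import all_boot all_order all_algebra all_field.
From mathcomp Require Import boolp classical_sets reals.

Set Implicit Arguments.
Unset Strict Implicit.
Unset Printing Implicit Defensive.

Import Order.TTheory GRing.Theory Num.Theory.

Local Open Scope ring_scope.

(** * Complex p-adic numbers *)

Section AbsoluteValue.
Variables (R : realType) (F : fieldType) (v : F -> R).

Definition nonarch_abs : Prop :=
  [/\ forall x, 0 <= v x,
      forall x, v x = 0 <-> x = 0,
      forall x y, v (x * y) = v x * v y
    & forall x y, v (x + y) <= Num.max (v x) (v y)].

Definition abs_cauchy (u : nat -> F) : Prop :=
  forall e : R, 0 < e ->
    exists N : nat, forall m n : nat, (N <= m)%N -> (N <= n)%N -> v (u m - u n) < e.

Definition abs_cvg (u : nat -> F) (l : F) : Prop :=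
  forall e : R, 0 < e ->
    exists N : nat, forall n : nat, (N <= n)%N -> v (u n - l) < e.

Definition abs_complete : Prop :=
  forall u, abs_cauchy u -> exists l, abs_cvg u l.

Definition abs_dense_range (E : Type) (f : E -> F) : Prop :=
  forall (x : F) (e : R), 0 < e -> exists a : E, v (x - f a) < e.

End AbsoluteValue.

(* [logn p 0 = 0], so the case [q = 0] is separate. *)
Definition padic_abs (R : realType) (p : nat) (q : rat) : R :=
  if q == 0 then 0
  else p%:R ^ ((logn p `|denq q|)%:Z - (logn p `|numq q|)%:Z).

(* The libraries have neither Q_p nor C_p. This record spells out "C_p is the
   completion of an algebraic closure of Q_p, the completion of the rationals
   for the p-adic absolute value": a tower  rat -> Qp -> Qpbar -> Cp  with an
   absolute value on its top. These data are unique up to isometric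
   isomorphism. On [rat], [Cp_abs_rat] forces characteristic 0, so that [ratr]
   is the embedding of the prime field. *)
Record complex_padics (R : realType) (p : nat) := ComplexPadics {
  Qp : fieldType;
  Qpbar : closedFieldType;
  Cp : fieldType;
  Qp_Qpbar : {rmorphism Qp -> Qpbar};
  Qpbar_Cp : {rmorphism Qpbar -> Cp};
  Cp_abs : Cp -> R;
  Qp_Cp : Qp -> Cp := fun a => Qpbar_Cp (Qp_Qpbar a);
  Qp_abs : Qp -> R := fun a => Cp_abs (Qp_Cp a);
  Cp_abs_nonarch : nonarch_abs Cp_abs;
  Cp_abs_rat : forall q : rat, Cp_abs (ratr q) = padic_abs R p q;
  Qp_complete : abs_complete Qp_abs;
  Qp_rat_dense : abs_dense_range Qp_abs (fun q : rat => ratr q);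
  Qpbar_algebraic : forall z : Qpbar, algebraicOver Qp_Qpbar z;
  Cp_complete : abs_complete Cp_abs;
  Cp_Qpbar_dense : abs_dense_range Cp_abs Qpbar_Cp
}.

Section PadicSubsets.
Variables (R : realType) (p : nat) (C : complex_padics R p).

(* Z_p, the valuation ring of Q_p, as a subset of C_p *)
Definition padic_int (y : Cp C) : Prop :=
  exists2 a : Qp C, Qp_abs a <= 1 & y = Qp_Cp a.

(* Gamma_r *)
Definition ramified_root (xi : Cp C) : Prop :=
  exists2 s : nat, (0 < s)%N & xi ^+ (p ^ s) = 1.

End PadicSubsets.

(** * Dirichlet characters *)

Definition dirichlet_character (d : nat) (chi : int -> algC) : Prop :=
  [/\ chi 1 = 1,
      forall a b, chi (a * b) = chi a * chi b,
      forall a b, (a = b %[mod d])%Z -> chi a = chi b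
    & forall a, chi a != 0 = coprimez a d].

(* [chi] has conductor [d]: no proper divisor of [d] is an induced modulus. *)
Definition primitive_character (d : nat) (chi : int -> algC) : Prop :=
  dirichlet_character d chi /\
  forall m : nat, (m %| d)%N -> (m < d)%N ->
    exists a : int, [/\ coprimez a d, (a = 1 %[mod m])%Z & chi a != 1].

(** * Generalized twisted Bernoulli polynomials *)

(* A power series in t is represented by its sequence of coefficients. *)
Section PowerSeries.
Variable A : comNzRingType.
Implicit Types f g : nat -> A.

Definition fps_sub f g : nat -> A := fun n => f n - g n.
Definition fps_mul f g : nat -> A := fun n => \sum_(i < n.+1) f i * g (n - i)%N.
Definition fps_scale (c : A) f : nat -> A := fun n => c * f n.
Definition fps_one : nat -> A := fun n => (n == 0)%:R.
Definition fps_t : nat -> A := fun n => (n == 1)%:R.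

End PowerSeries.

Section TwistedBernoulli.
Variable K : fieldType.

(* The coefficient ring is {poly K}, whose indeterminate 'X is the variable x
   of the Bernoulli polynomials. *)
(* sum_n b_n t^n / n! *)
Definition egf (b : nat -> {poly K}) : nat -> {poly K} :=
  fun n => (n`!%:R^-1 : K) *: b n.

(* e^(c t) *)
Definition fps_exp (c : {poly K}) : nat -> {poly K} := egf (fun n => c ^+ n).

Variables (d : nat) (chi : int -> K) (eta : K).

Definition bernoulli_den : nat -> {poly K} :=
  fps_sub (fps_scale (eta ^+ d)%:P (fps_exp d%:R)) (fps_one {poly K}).

Definition bernoulli_num : nat -> {poly K} :=
  fps_mul (fps_mul (fps_t {poly K}) (fps_exp 'X))
    (fun n => \sum_(0 <= a < d) fps_scale (chi a%:Z * eta ^+ a)%:P (fps_exp a%:R) n).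

(* The defining expansion  num / den = sum_n B_n(x) t^n / n!,  cleared of its
   denominator (which has no constant term when eta^d = 1). *)
Definition bernoulli_expansion (B : nat -> {poly K}) : Prop :=
  fps_mul bernoulli_den (egf B) = bernoulli_num.

(* The family B_(n,chi,eta); [twisted_bernoulliP] and
   [bernoulli_expansion_uniq] show that it is well defined. *)
Definition twisted_bernoulli : nat -> {poly K} :=
  xget (fun=> 0) [set B | bernoulli_expansion B].

End TwistedBernoulli.

Section WellDefined.

Lemma fps_div_exists (A : comUnitRingType) (f g : nat -> A) :
  g 0 \is a GRing.unit -> exists h, fps_mul g h = f.
Proof.
move=> g0.
pose step (s : seq A) :=
  rcons s ((g 0)^-1 * (f (size s) - \sum_(i < size s) g i.+1 * s`_(size s - i.+1))).
pose s n := iter n step [::].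
have sz n : size (s n) = n by elim: n => //= n IH; rewrite size_rcons IH.
have st m n : (n < m)%N -> (s m)`_n = (s n.+1)`_n.
  elim: m => // m IH; rewrite ltnS leq_eqVlt => /orP[/eqP->//|lt].
  by rewrite -IH //= nth_rcons sz lt.
exists (fun n => (s n.+1)`_n); apply/funext => n; rewrite /fps_mul big_ord_recl subn0.
rewrite [X in _ + X](_ : _ = \sum_(i < n) g i.+1 * (s n)`_(n - i.+1)); last first.
  apply: eq_bigr => i _; rewrite [nat_of_ord _]lift0 -(st n) //.
  by rewrite ltn_subrL (leq_ltn_trans _ (ltn_ord i)).
rewrite [s n.+1]/= nth_rcons sz ltnn eqxx mulrA divrr // mul1r.
by rewrite subrK.
Qed.

Variables (K : fieldType) (d : nat) (chi : int -> K) (eta : K).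
Hypotheses (char0 : [pchar K] =i pred0) (d_gt0 : (0 < d)%N).

Let den := bernoulli_den d eta.

Let den0 : den 0 = (eta ^+ d - 1)%:P.
Proof.
by rewrite /den /bernoulli_den /fps_sub /fps_scale /fps_exp /egf /fps_one /=
  expr0 fact0 invr1 scale1r mulr1 polyCB.
Qed.

Let den1 : den 1 = (eta ^+ d * d%:R)%:P.
Proof.
by rewrite /den /bernoulli_den /fps_sub /fps_scale /fps_exp /egf /fps_one /=
  expr1 invr1 scale1r subr0 polyCM polyC_natr.
Qed.

Let dn0 : (d%:R : K) != 0.
Proof. by rewrite (iffLR (pcharf0P K) char0) -lt0n. Qed.

Let fact_n0 n : (n`!%:R : K) != 0.
Proof. by rewrite (iffLR (pcharf0P K) char0) -lt0n fact_gt0. Qed.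

Let egf_surj (h : nat -> {poly K}) : exists B, egf B = h.
Proof.
exists (fun n => (n`!%:R : K) *: h n); apply/funext => n.
by rewrite /egf scalerA mulVf // scale1r.
Qed.

Lemma bernoulli_expansion_exists : exists B, bernoulli_expansion d chi eta B.
Proof.
suff [h hE] : exists h, fps_mul den h = bernoulli_num d chi eta.
  by have [B BE] := egf_surj h; exists B; rewrite /bernoulli_expansion BE.
have [eta1|eta1] := eqVneq (eta ^+ d) 1; last first.
  by apply: fps_div_exists; rewrite den0 poly_unitE size_polyC coefC /= subr_eq0
    eta1 unitfE subr_eq0 eta1.
have [|h hE] := @fps_div_exists {poly K}
    (fun n => bernoulli_num d chi eta n.+1) (fun n => den n.+1).
  by rewrite den1 eta1 mul1r poly_unitE size_polyC coefC /= dn0 unitfE dn0.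
exists h; apply/funext => -[|n].
  rewrite /fps_mul big_ord_recl big_ord0 den0 eta1 subrr polyC0 mul0r.
  by rewrite /bernoulli_num {1}/fps_mul big_ord_recl big_ord0
    /fps_mul big_ord_recl big_ord0 /fps_t !mul0r !addr0 mul0r.
transitivity (fps_mul (fun n => den n.+1) h n); last by rewrite hE.
by rewrite /fps_mul big_ord_recl den0 eta1 subrr polyC0 mul0r add0r.
Qed.

Lemma bernoulli_expansion_uniq B1 B2 :
  bernoulli_expansion d chi eta B1 -> bernoulli_expansion d chi eta B2 -> B1 = B2.
Proof.
move=> E1 E2; have E n : fps_mul den (egf B1) n = fps_mul den (egf B2) n.
  by rewrite /bernoulli_expansion in E1 E2; rewrite [LHS](congr1 (@^~ n) E1) -E2.
have egfE n : egf B1 n = egf B2 n -> B1 n = B2 n.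
  by move=> /(congr1 ( *:%R (n`!%:R : K))); rewrite !scalerA divff // !scale1r.
apply/funext => n; apply: egfE; elim/ltn_ind: n => n IH.
have [eta1|eta1] := eqVneq (eta ^+ d) 1.
  have := E n.+1; rewrite /fps_mul !big_ord_recl den0 eta1 subrr polyC0 !mul0r !add0r.
  rewrite !lift0 !subSS !subn0 den1 eta1 mul1r => H.
  apply: (@mulfI _ (d%:R)%:P); first by rewrite polyC_eq0.
  apply: (addIr _ (etrans H _)); congr (_ + _); apply: eq_bigr => i _.
  by rewrite IH // !lift0 subSS ltn_subrL /= (leq_ltn_trans _ (ltn_ord i)).
have := E n; rewrite /fps_mul !big_ord_recl !subn0 den0 => H.
apply: (@mulfI _ (eta ^+ d - 1)%:P); first by rewrite polyC_eq0 subr_eq0.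
apply: (addIr _ (etrans H _)); congr (_ + _); apply: eq_bigr => i _.
by rewrite IH // !lift0 ltn_subrL /= (leq_ltn_trans _ (ltn_ord i)).
Qed.

Lemma twisted_bernoulliP :
  bernoulli_expansion d chi eta (twisted_bernoulli d chi eta).
Proof. exact: (xgetPex _ bernoulli_expansion_exists). Qed.

End WellDefined.

Lemma Cp_char0 (R : realType) (p : nat) (C : complex_padics R p) :
  prime p -> [pchar (Cp C)] =i pred0.
Proof.
move=> p_prime; apply/pcharf0P => n; apply/idP/idP => [/eqP n0|/eqP->//].
have [v0 vE _ _] := @Cp_abs_nonarch R p C.
have := Cp_abs_rat C n%:Q; rewrite /ratr numq_int denq_int invr1 mulr1 /=.
rewrite -[_%:~R]/(n%:R : Cp C) n0 (iffRL (vE 0) erefl) /padic_abs intr_eq0.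
case: eqP => [[->]//|_] /esym/eqP; rewrite expfz_eq0 pnatr_eq0.
by rewrite eqn0Ngt prime_gt0 // andbF.
Qed.

(* Main.v *)
(* With N = w1 w2 w3, the generating function of B_k(w1 y) at (w2 w3) t is
   e^(N y t) times a power series free of y, namely its value at y = 0. Each of
   the six sums is n! times the coefficient of t^n in the product of three such
   generating functions, hence in the product of one factor symmetric in
   w1, w2, w3 and of the factors e^(N yi t), which are the same in all six. *)
Require Import Defs.
From HB Require Import structures.
From mathcomp Require Import all_boot all_order all_algebra all_field.
From mathcomp Require Import boolp classical_sets reals.
From mathcomp Require Import zify ring.

Import Order.TTheory GRing.Theory Num.Theory.

Local Open Scope ring_scope.

Section PowerSeriesProduct.
Variable A : comNzRingType.
Implicit Types f g h : nat -> A.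

(** The coefficient of degree n in a Cauchy product sees only entries of index at most n, so the
    laws of [fps_mul] can be read off from truncations in [{poly A}]. *)
Let trunc N f : {poly A} := \poly_(i < N) f i.

Let coef_trunc_mul N f g n :
  (n < N)%N -> (trunc N f * trunc N g)`_n = fps_mul f g n.
Proof.
move=> nN; rewrite coefM; apply: eq_bigr => i _.
by rewrite !coef_poly !(leq_ltn_trans _ nN) ?leq_subr ?leq_ord.
Qed.

Lemma fps_mulC : commutative (@fps_mul A).
Proof.
by move=> f g; apply/funext => n; rewrite -!(coef_trunc_mul _ _ _ _ (ltnSn n)) mulrC.
Qed.

Lemma fps_mulA : associative (@fps_mul A).
Proof.
have mulE f g h n :
    fps_mul (fps_mul f g) h n = (trunc n.+1 f * trunc n.+1 g * trunc n.+1 h)`_n.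
  rewrite coefM; apply: eq_bigr => i _.
  by rewrite coef_trunc_mul // coef_poly ltnS leq_subr.
(* Commuting [f] to the right brings both sides to the left-nested shape that [mulE] handles. *)
move=> f g h; rewrite (fps_mulC f); apply/funext => n; rewrite !mulE.
by rewrite mulrC mulrA.
Qed.

Lemma fps_mul1 f : fps_mul f (fps_one A) = f.
Proof.
apply/funext => n; rewrite /fps_mul big_ord_recr /= subnn mulr1.
rewrite big1 ?add0r // => i _.
by rewrite /fps_one subn_eq0 leqNgt ltn_ord mulr0.
Qed.

Lemma fps_map_mul (B : comNzRingType) (phi : {rmorphism A -> B}) f g :
  phi \o fps_mul f g = fps_mul (phi \o f) (phi \o g).
Proof.
apply/funext => n; rewrite /fps_mul /= rmorph_sum.
by apply: eq_bigr => i _; rewrite rmorphM.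
Qed.

(** Substituting c t for t is multiplicative. *)
Lemma fps_mul_dilate (c : A) f g n :
  c ^+ n * fps_mul f g n = fps_mul (fun i => c ^+ i * f i) (fun i => c ^+ i * g i) n.
Proof.
rewrite /fps_mul mulr_sumr; apply: eq_bigr => i _.
by rewrite mulrACA -exprD subnKC // leq_ord.
Qed.

Lemma fps_mul3E f g h n :
  \sum_(k < n.+1) \sum_(l < n.+1) \sum_(m < n.+1 | (k + l + m == n)%N)
    f k * g l * h m = fps_mul (fps_mul f g) h n.
Proof.
rewrite -fps_mulA [RHS]/fps_mul; apply: eq_bigr => k _.
rewrite /fps_mul mulr_sumr.
(* Both sides now have [l] up to n. If l <= n - k, the only admissible [m] is n - k - l; otherwise
   there is none. *)
rewrite (big_ord_widen n.+1 (fun i => f k * (g i * h (n - k - i)%N))) ?ltnS ?leq_subr //.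
rewrite [RHS]big_mkcond; apply: eq_bigr => l _; rewrite ltnS.
have kn := leq_ord k; case: leqP => [ln|nl].
  have mn : (n - k - l < n.+1)%N by rewrite ltnS -subnDA leq_subr.
  rewrite (big_pred1 (Ordinal mn)) ?mulrA // => m; rewrite /= -val_eqE /=.
  apply/eqP/eqP; lia.
by rewrite big_pred0 // => m; apply/eqP; lia.
Qed.

End PowerSeriesProduct.

Section BernoulliSymmetry.
Variables (K : fieldType) (d : nat) (chi : int -> K).
Hypotheses (char0 : [pchar K] =i pred0) (d_gt0 : (0 < d)%N).

(* The constant terms [(B n).[0]] satisfy the expansion at [x = 0]; multiplying
   by [e^(X t)] gives a solution of the full expansion, which is unique. *)
Lemma twisted_bernoulli_exp (eta x : K) n (B := twisted_bernoulli d chi eta) :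
  n`!%:R^-1 * (B n).[x] =
  fps_mul (fun i => i`!%:R^-1 * (B i).[0]) (fun i => i`!%:R^-1 * x ^+ i) n.
Proof.
have fact_n0 m : (m`!%:R : K) != 0.
  by rewrite (iffLR (pcharf0P K) char0) -lt0n fact_gt0.
(* Evaluation at x = 0, re-embedded as constants so that it acts on the coefficients of the
   expansion itself. *)
pose at0 : {rmorphism {poly K} -> {poly K}} := polyC \o horner_eval 0.
have at0C c : at0 c%:P = c%:P by rewrite /at0 /= /horner_eval hornerC.
have BP : bernoulli_expansion d chi eta B by exact: twisted_bernoulliP.
pose B' m := (m`!%:R : K) *: fps_mul (at0 \o egf B) (fps_exp 'X) m.
have egfB' : egf B' = fps_mul (at0 \o egf B) (fps_exp 'X).
  by apply/funext => m; rewrite /egf /B' scalerA mulVf // scale1r.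
have at0exp m c : at0 (fps_exp c m) = fps_exp (at0 c) m.
  by rewrite /fps_exp /egf -!mul_polyC rmorphM at0C rmorphXn.
(* The denominator is free of x; in the numerator only e^(x t) depends on x, and it becomes 1. *)
have at0den : at0 \o bernoulli_den d eta = bernoulli_den d eta.
  apply/funext => m; rewrite /bernoulli_den /fps_sub /fps_scale /fps_one /=.
  by rewrite -[polyC _]/(at0 _) rmorphB rmorphM at0C at0exp !rmorph_nat.
have B'P : bernoulli_expansion d chi eta B'.
  rewrite /bernoulli_expansion egfB' fps_mulA -at0den.
  rewrite -fps_map_mul [fps_mul _ (egf B)]BP /bernoulli_num !fps_map_mul.
  have -> : at0 \o fps_t {poly K} = fps_t {poly K}.
    by apply/funext => m; rewrite /fps_t /= -[polyC _]/(at0 _) rmorph_nat.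
  have -> : at0 \o fps_exp 'X = fps_one {poly K}.
    apply/funext => m; rewrite -[LHS]/(at0 (fps_exp 'X m)) at0exp.
    rewrite /at0 /= /horner_eval hornerX /fps_exp /egf expr0n.
    by case: m => [|m]; rewrite ?invr1 ?scale1r // scaler0.
  rewrite fps_mul1 -!fps_mulA; congr fps_mul; rewrite fps_mulC; congr fps_mul.
  apply/funext => m; rewrite -[LHS]/(at0 _) rmorph_sum; apply: eq_bigr => a _.
  by rewrite /fps_scale rmorphM at0C at0exp rmorph_nat.
transitivity (egf B n).[x]; first by rewrite /egf hornerZ.
rewrite [in LHS](bernoulli_expansion_uniq char0 d_gt0 BP B'P) egfB' /fps_mul horner_sum.
apply: eq_bigr => i _; rewrite hornerM /at0 /= /horner_eval hornerC.
by rewrite /fps_exp /egf !hornerZ hornerXn.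
Qed.

(** Stated for arbitrary [u], [v], [w] to cover all six orderings. [N] and the exponents enter
    through equations, so each ordering can use the same expressions for them. [H e] is the
    generating function at y = 0, dilated by [e]; [E x] is e^(N x t). *)
Lemma bernoulli_sum3E (xi : K) (N e1 e2 e3 u v w n : nat) (x1 x2 x3 : K)
    (B := fun k e x => (twisted_bernoulli d chi (xi ^+ e) k).[x])
    (H := fun e i => e%:R ^+ i * (i`!%:R^-1 * B i e 0))
    (E := fun x i => i`!%:R^-1 * (N%:R * x) ^+ i) :
  N = (u * v * w)%N -> e1 = (v * w)%N -> e2 = (u * w)%N -> e3 = (u * v)%N ->
  \sum_(k < n.+1) \sum_(l < n.+1) \sum_(m < n.+1 | (k + l + m == n)%N)
    n`!%:R / (k`!%:R * l`!%:R * m`!%:R) *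
    (B k e1 (u%:R * x1) * B l e2 (v%:R * x2) * B m e3 (w%:R * x3)
      * u%:R ^+ (l + m) * v%:R ^+ (k + m) * w%:R ^+ (k + l)) =
  n`!%:R * fps_mul (fps_mul (fps_mul (H e1) (H e2)) (H e3))
                   (fps_mul (fps_mul (E x1) (E x2)) (E x3)) n.
Proof.
move=> NE e1E e2E e3E.
have factorE e a x : (e * a = N)%N ->
    (fun k => e%:R ^+ k * (k`!%:R^-1 * B k e (a%:R * x))) = fps_mul (H e) (E x).
  move=> eaE; apply/funext => k; rewrite twisted_bernoulli_exp fps_mul_dilate.
  apply: eq_bigr => i _; congr (_ * _).
  by rewrite /E -eaE natrM -mulrA mulrCA -exprMn.
have -> : fps_mul (fps_mul (fps_mul (H e1) (H e2)) (H e3))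
                  (fps_mul (fps_mul (E x1) (E x2)) (E x3)) =
    fps_mul (fps_mul (fps_mul (H e1) (E x1)) (fps_mul (H e2) (E x2)))
            (fps_mul (H e3) (E x3)).
  (* Regrouping pairs each [H] with its own exponential. *)
  have mulACA : interchange (@fps_mul K) (@fps_mul K).
    by move=> f g h k; rewrite -!fps_mulA (fps_mulA _ g) (fps_mulC _ g) !fps_mulA.
  by rewrite mulACA (mulACA (H e1)).
rewrite -(factorE e1 u) -?(factorE e2 v) -?(factorE e3 w); try by lia.
rewrite -fps_mul3E mulr_sumr; apply: eq_bigr => k _.
rewrite mulr_sumr; apply: eq_bigr => l _; rewrite mulr_sumr.
(* The weights u^(l+m) v^(k+m) w^(k+l) are the dilation factors (v w)^k (u w)^l (u v)^m. *)
apply: eq_bigr => m _; rewrite e1E e2E e3E !natrM !exprMn !exprD !invfM.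
by ring.
Qed.

End BernoulliSymmetry.

Theorem theorem4p1 (R : realType) (p : nat) (p_prime : prime p)
    (C : complex_padics R p) (iota : {rmorphism algC -> Cp C})
    (xi : Cp C) (xi_ram : ramified_root xi)
    (d : nat) (d_gt0 : (0 < d)%N)
    (chi : int -> algC) (chi_prim : primitive_character d chi)
    (w1 w2 w3 : nat) (w1_gt0 : (0 < w1)%N) (w2_gt0 : (0 < w2)%N) (w3_gt0 : (0 < w3)%N)
    (n : nat) (y1 y2 y3 : Cp C)
    (y1_int : padic_int y1) (y2_int : padic_int y2) (y3_int : padic_int y3) :
  let B (k e : nat) (x : Cp C) : Cp C :=
    (twisted_bernoulli d (fun a : int => iota (chi a)) (xi ^+ e) k).[x] in
  let trinom (k l m : nat) : Cp C := n`!%:R / (k`!%:R * l`!%:R * m`!%:R) in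
  let sum3 (F : nat -> nat -> nat -> Cp C) : Cp C :=
    \sum_(k < n.+1) \sum_(l < n.+1) \sum_(m < n.+1 | (k + l + m == n)%N)
      trinom k l m * F k l m in
  let E1 := sum3 (fun k l m =>
    B k (w2 * w3)%N (w1%:R * y1) * B l (w1 * w3)%N (w2%:R * y2)
      * B m (w1 * w2)%N (w3%:R * y3)
      * w1%:R ^+ (l + m) * w2%:R ^+ (k + m) * w3%:R ^+ (k + l)) in
  let E2 := sum3 (fun k l m =>
    B k (w2 * w3)%N (w1%:R * y1) * B l (w1 * w2)%N (w3%:R * y2)
      * B m (w1 * w3)%N (w2%:R * y3)
      * w1%:R ^+ (l + m) * w3%:R ^+ (k + m) * w2%:R ^+ (k + l)) in
  let E3 := sum3 (fun k l m =>
    B k (w1 * w3)%N (w2%:R * y1) * B l (w2 * w3)%N (w1%:R * y2)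
      * B m (w1 * w2)%N (w3%:R * y3)
      * w2%:R ^+ (l + m) * w1%:R ^+ (k + m) * w3%:R ^+ (k + l)) in
  let E4 := sum3 (fun k l m =>
    B k (w1 * w3)%N (w2%:R * y1) * B l (w1 * w2)%N (w3%:R * y2)
      * B m (w2 * w3)%N (w1%:R * y3)
      * w2%:R ^+ (l + m) * w3%:R ^+ (k + m) * w1%:R ^+ (k + l)) in
  let E5 := sum3 (fun k l m =>
    B k (w1 * w2)%N (w3%:R * y1) * B l (w2 * w3)%N (w1%:R * y2)
      * B m (w1 * w3)%N (w2%:R * y3)
      * w3%:R ^+ (l + m) * w1%:R ^+ (k + m) * w2%:R ^+ (k + l)) in
  let E6 := sum3 (fun k l m =>
    B k (w1 * w2)%N (w3%:R * y1) * B l (w1 * w3)%N (w2%:R * y2)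
      * B m (w2 * w3)%N (w1%:R * y3)
      * w3%:R ^+ (l + m) * w2%:R ^+ (k + m) * w1%:R ^+ (k + l)) in
  [/\ E1 = E2, E2 = E3, E3 = E4, E4 = E5 & E5 = E6].
Proof.
move=> B trinom sum3 E1 E2 E3 E4 E5 E6.
pose N := (w1 * w2 * w3)%N.
have sum3E := @bernoulli_sum3E _ d (fun a => iota (chi a))
  (Cp_char0 C p_prime) d_gt0 xi N.
pose H e i : Cp C := e%:R ^+ i * (i`!%:R^-1 * B i e 0).
pose E x i : Cp C := i`!%:R^-1 * (N%:R * x) ^+ i.
pose G e1 e2 e3 : Cp C := n`!%:R * fps_mul (fps_mul (fps_mul (H e1) (H e2)) (H e3))
                            (fps_mul (fps_mul (E y1) (E y2)) (E y3)) n.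
(* Two adjacent transpositions generate all permutations of the [H] factors, while the [E] factors
   stay in place. *)
have GC e1 e2 e3 : G e1 e2 e3 = G e2 e1 e3 by rewrite /G (fps_mulC _ (H e1)).
have GAC e1 e2 e3 : G e1 e2 e3 = G e1 e3 e2.
  by rewrite /G -(fps_mulA _ (H e1)) (fps_mulC _ (H e2)) (fps_mulA _ (H e1)).
have -> : E1 = G (w2 * w3)%N (w1 * w3)%N (w1 * w2)%N by apply: sum3E; lia.
have -> : E2 = G (w2 * w3)%N (w1 * w2)%N (w1 * w3)%N by apply: sum3E; lia.
have -> : E3 = G (w1 * w3)%N (w2 * w3)%N (w1 * w2)%N by apply: sum3E; lia.
have -> : E4 = G (w1 * w3)%N (w1 * w2)%N (w2 * w3)%N by apply: sum3E; lia.
have -> : E5 = G (w1 * w2)%N (w2 * w3)%N (w1 * w3)%N by apply: sum3E; lia.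
have -> : E6 = G (w1 * w2)%N (w1 * w3)%N (w2 * w3)%N by apply: sum3E; lia.
split; [exact: GAC | by rewrite GAC GC | exact: GAC | by rewrite GC GAC | exact: GAC].
Qed.
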